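(* For each $n\in\mathbb{N}$, let $A_n$ be the number of strong-Schreier sets $S$ with $\max S=n$; let $B_n$ be the number of maximal sets $S$ with $\max S=n$; let $C_n$ be the number of weak-Schreier subsets of $\{1,2,\ldots,n\}$ (including the empty set); and let $D_n$ be the number of strong-Schreier subsets of $\{1,2,\ldots,n\}$ (including the empty set). Then for each $n\in\mathbb{N}$, $A_n=F_{n-1}$, $B_n=F_{n-2}$, $C_n=F_{n+2}$ and $D_n=F_{n+1}$.
   Context: $\mathbb{N}=\{1,2,3,\ldots\}$. All sets considered are finite subsets of $\mathbb{N}$. A nonempty finite set $S\subseteq\mathbb{N}$ is weak-Schreier if $\min S\ge |S|$, strong-Schreier if $\min S>|S|$, and maximal if $\min S=|S|$, where $|S|$ is the cardinality of $S$. The empty set is counted as weak-Schreier and strong-Schreier. The Fibonacci sequence $(F_n)_{n\ge -1}$ is defined by $F_{-1}=1$, $F_0=0$, and $F_m=F_{m-1}+F_{m-2}$ for all $m\ge 1$. *)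

(* Defs.v *)
From mathcomp Require Import all_boot all_order all_algebra finmap.
From mathcomp Require Import boolp classical_sets cardinality.

Set Implicit Arguments.
Unset Strict Implicit.
Unset Printing Implicit Defensive.

Import Order.TTheory GRing.Theory Num.Theory.

Local Open Scope fset_scope.
Local Open Scope nat_scope.

(* A finite subset of {1, 2, 3, ...} is a finite set of naturals without 0. *)
Definition pos_fset (S : {fset nat}) : bool := 0 \notin S.

Definition fset_max (S : {fset nat}) : nat := \max_(x <- S) x.

(* Starting the iterated minimum at the maximum makes this the least element
   of every nonempty S; fset_min fset0 = 0 is a junk value. *)
Definition fset_min (S : {fset nat}) : nat :=
  \big[minn/fset_max S]_(x <- S) x.

Definition weak_schreier (S : {fset nat}) : bool :=
  pos_fset S && ((S == fset0) || (#|` S| <= fset_min S)).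

Definition strong_schreier (S : {fset nat}) : bool :=
  pos_fset S && ((S == fset0) || (#|` S| < fset_min S)).

Definition maximal_schreier (S : {fset nat}) : bool :=
  [&& pos_fset S, S != fset0 & fset_min S == #|` S|].

Definition interval_fset (n : nat) : {fset nat} := [fset x in iota 1 n].

Definition strong_schreier_with_max (n : nat) : set {fset nat} :=
  [set S | [/\ strong_schreier S, S != fset0 & fset_max S = n]]%classic.

Definition maximal_schreier_with_max (n : nat) : set {fset nat} :=
  [set S | maximal_schreier S /\ fset_max S = n]%classic.

Definition weak_schreier_subsets (n : nat) : set {fset nat} :=
  [set S | weak_schreier S /\ (S `<=` interval_fset n)%fset]%classic.

Definition strong_schreier_subsets (n : nat) : set {fset nat} :=
  [set S | strong_schreier S /\ (S `<=` interval_fset n)%fset]%classic.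

Fixpoint fib_nat (n : nat) : nat :=
  match n with
  | 0 => 0
  | 1 => 1
  | (m.+1 as p).+1 => fib_nat p + fib_nat m
  end.

(* The Fibonacci sequence indexed from -1; indices below -1 get the junk
   value 0. *)
Definition fib (m : int) : nat :=
  match m with
  | Posz n => fib_nat n
  | Negz 0 => 1
  | Negz _ => 0
  end.

Lemma fibN1 : fib (-1)%R = 1. Proof. by []. Qed.

Lemma fib0 : fib 0%R = 0. Proof. by []. Qed.

Lemma fib_rec (m : int) : (1 <= m)%R -> fib m = fib (m - 1)%R + fib (m - 2)%R.
Proof.
case: m => [[|[|n]]|n] // _.
have -> : (n.+2%:Z - 1 = n.+1%:Z)%R by rewrite -[n.+2]addn1 PoszD addrK.
have -> // : (n.+2%:Z - 2 = n%:Z)%R by rewrite -[n.+2]addn2 PoszD addrK.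
Qed.

Lemma fset_max_ge (S : {fset nat}) (x : nat) : x \in S -> x <= fset_max S.
Proof. by move=> xS; rewrite /fset_max (big_rem x xS) /= leq_maxl. Qed.

Lemma fset_max_mem (S : {fset nat}) : S != fset0 -> fset_max S \in S.
Proof.
case/fset0Pn => x xS.
suff H (s : seq nat) y : y \in s -> \max_(z <- s) z \in s by exact: H xS.
elim: s y => // a [|b s] IH y _; first by rewrite big_seq1 mem_head.
have H := IH b (mem_head _ _); rewrite big_cons in_cons /maxn.
by case: ifP => _; rewrite ?H ?eqxx ?orbT.
Qed.

Lemma fset_min_le (S : {fset nat}) (x : nat) : x \in S -> fset_min S <= x.
Proof.
rewrite /fset_min; move: (fset_max S) => k xS; have : x \in enum_fset S by [].
elim: (enum_fset S) => // a s IH; rewrite inE big_cons geq_min.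
by case/orP => [/eqP->|/IH->]; rewrite ?leqnn ?orbT.
Qed.

Lemma fset_min_mem (S : {fset nat}) : S != fset0 -> fset_min S \in S.
Proof.
move=> /fset_max_mem maxS; rewrite /fset_min big_seq.
apply: (big_ind (fun y => y \in S)) => // a b aS bS.
by rewrite /minn; case: ifP.
Qed.

(* Main.v *)
(* Shift the size: call S k-Schreier when #|S| + k <= x for every x in S, so
   that k = 0 is weak and k = 1 is strong.  Deleting the maximum n.+1 of a
   k-Schreier set leaves a k.+1-Schreier subset of {1, ..., n}, and conversely
   as soon as k <= n.  Hence the number N k n of k-Schreier subsets of
   {1, ..., n} satisfies N k n.+1 = N k n + N k.+1 n for k <= n, while N k n = 1
   for n <= k; so N k n = F_(n + 2 - k) for k <= n.+1.  Maximal sets are the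
   weak ones that are not strong. *)
Require Import Defs.
From mathcomp Require Import all_boot all_order all_algebra finmap.
From mathcomp Require Import boolp classical_sets cardinality.
From mathcomp Require Import zify.

Local Open Scope fset_scope.

(** Bounding every element rather than the minimum lets the empty set qualify vacuously and keeps
    the default value of [fset_min] out of the counting. *)
Definition shifted_schreier (k : nat) (S : {fset nat}) : bool :=
  all (fun x => #|` S| + k <= x) (enum_fset S).

Definition shifted_schreier_subsets (k n : nat) : {fset {fset nat}} :=
  [fset S in fpowerset (interval_fset n) | shifted_schreier k S].

Definition shifted_schreier_with_max (k n : nat) : {fset {fset nat}} :=
  [fset S in shifted_schreier_subsets k n | n \in S].

Lemma shifted_schreierP k (S : {fset nat}) :
  reflect (forall x, x \in S -> #|` S| + k <= x) (shifted_schreier k S).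
Proof. exact: allP. Qed.

Lemma in_interval_fset n x : (x \in interval_fset n) = (0 < x <= n).
Proof. by rewrite /interval_fset in_fset_ /= mem_iota add1n ltnS. Qed.

Lemma sub_interval_fsetP n (S : {fset nat}) :
  reflect (forall x, x \in S -> 0 < x <= n) (S `<=` interval_fset n).
Proof.
by apply: (iffP (@fsubsetP _ S (interval_fset n))) => H x /H;
  rewrite in_interval_fset.
Qed.

Lemma in_shifted_schreier_subsets k n S :
  (S \in shifted_schreier_subsets k n) =
  (S `<=` interval_fset n) && shifted_schreier k S.
Proof. by rewrite !inE /= fpowersetE. Qed.

Lemma in_shifted_schreier_with_max k n S :
  (S \in shifted_schreier_with_max k n) =
  (S \in shifted_schreier_subsets k n) && (n \in S).
Proof. by rewrite !inE. Qed.

Lemma succ_notin_interval_sub n (S : {fset nat}) :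
  S `<=` interval_fset n -> n.+1 \notin S.
Proof. by move=> /sub_interval_fsetP H; apply/negP => /H; lia. Qed.

Lemma shifted_schreier_with_maxS k n : k <= n ->
  shifted_schreier_with_max k n.+1 =
  [fset n.+1 |` T | T in shifted_schreier_subsets k.+1 n].
Proof.
move=> kn; apply/fsetP => S; rewrite in_shifted_schreier_with_max.
apply/idP/imfsetP => /=.
- rewrite in_shifted_schreier_subsets.
  case/andP => /andP[/sub_interval_fsetP Sn /shifted_schreierP Sk] nS.
  exists (S `\ n.+1); last by rewrite fsetD1K.
  rewrite in_shifted_schreier_subsets.
  have cS : #|` S| = (#|` S `\ n.+1|).+1 by rewrite (cardfsD1 n.+1 S) nS.
  apply/andP; split.
    by apply/sub_interval_fsetP => x /fsetD1P[xn /Sn]; lia.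
  by apply/shifted_schreierP => x /fsetD1P[xn /Sk]; lia.
- case=> T; rewrite in_shifted_schreier_subsets => /andP[Tn Tk] ->.
  have nT := succ_notin_interval_sub _ _ Tn.
  rewrite in_shifted_schreier_subsets fset1U1 andbT.
  move/sub_interval_fsetP: Tn => Tn; move/shifted_schreierP: Tk => Tk.
  apply/andP; split.
    by apply/sub_interval_fsetP => x /fset1UP[->|/Tn]; lia.
  apply/shifted_schreierP => x /fset1UP; rewrite cardfsU1 nT.
  case=> [->|/Tk]; last lia.
  have [->|/fset0Pn[y yT]] := eqVneq T fset0; first by rewrite cardfs0; lia.
  by have := Tk _ yT; have := Tn _ yT; lia.
Qed.

Lemma card_shifted_schreier_with_maxS k n : k <= n ->
  #|` shifted_schreier_with_max k n.+1| = #|` shifted_schreier_subsets k.+1 n|.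
Proof.
move=> kn; rewrite shifted_schreier_with_maxS // card_in_imfset // => S T /=.
rewrite !in_shifted_schreier_subsets.
move=> /andP[/succ_notin_interval_sub nS _] /andP[/succ_notin_interval_sub nT _].
(* Inserting [n.+1] is injective here: neither set contains it, so deleting it recovers the set. *)
by move=> /(congr1 (fun U => U `\ n.+1)); rewrite !fsetU1K.
Qed.

Lemma shifted_schreier_with_max_eq0 k n : n <= k ->
  shifted_schreier_with_max k n = fset0.
Proof.
move=> nk; apply/fsetP => S; rewrite in_shifted_schreier_with_max inE.
apply/negP => /andP[]; rewrite in_shifted_schreier_subsets => /andP[_].
move=> /shifted_schreierP Sk nS; have := Sk n nS.
by rewrite (cardfsD1 n S) nS; lia.
Qed.

(** The sets are split according to whether they contain [n.+1]. *)
Lemma card_shifted_schreier_subsetsS k n :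
  #|` shifted_schreier_subsets k n.+1| =
  (#|` shifted_schreier_subsets k n| +
   #|` shifted_schreier_with_max k n.+1|)%N.
Proof.
have -> : shifted_schreier_subsets k n.+1 =
    shifted_schreier_subsets k n `|` shifted_schreier_with_max k n.+1.
  apply/fsetP => S; rewrite in_fsetU in_shifted_schreier_with_max.
  rewrite !in_shifted_schreier_subsets.
  case: (shifted_schreier k S); rewrite ?andbF // !andbT.
  apply/idP/orP => [/sub_interval_fsetP H|].
  - case nS: (n.+1 \in S); first by right; rewrite andbT; apply/sub_interval_fsetP.
    left; apply/sub_interval_fsetP => x xS; have := H x xS.
    have : x != n.+1 by apply: contraFneq nS => <-.
    lia.
  - case=> [/sub_interval_fsetP H|/andP[] //].
    by apply/sub_interval_fsetP => x /H; lia.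
rewrite -cardfsUI; suff -> : shifted_schreier_subsets k n
    `&` shifted_schreier_with_max k n.+1 = fset0 by rewrite cardfs0 addn0.
apply/fsetP => S; rewrite in_fsetI in_shifted_schreier_with_max inE.
apply/negP => /and3P[]; rewrite in_shifted_schreier_subsets.
by move=> /andP[/succ_notin_interval_sub /negP].
Qed.

Lemma shifted_schreier_subsets_trivial k n : n <= k ->
  shifted_schreier_subsets k n = [fset fset0].
Proof.
move=> nk; apply/fsetP => S; rewrite in_shifted_schreier_subsets inE.
apply/andP/eqP => [[/sub_interval_fsetP Sn /shifted_schreierP Sk]|->].
  apply/eqP; apply/negPn/negP => /fset0Pn[x xS].
  by have := Sn x xS; have := Sk x xS; rewrite (cardfsD1 x S) xS; lia.
by split; [exact: fsub0set | apply/shifted_schreierP].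
Qed.

(** Induction on [n] for all [k] at once, since the recurrence raises [k]. The range reaches [n.+1]
    so that the induction hypothesis covers [k.+1] whenever [k <= n]. *)
Lemma card_shifted_schreier_subsets k n : k <= n.+1 ->
  #|` shifted_schreier_subsets k n| = fib_nat (n.+2 - k).
Proof.
elim: n k => [|n IH] k kn.
  by rewrite shifted_schreier_subsets_trivial // cardfs1; case: k kn => [|[|]].
have [kn1|kn1] := leqP k n.
  rewrite card_shifted_schreier_subsetsS card_shifted_schreier_with_maxS //.
  rewrite !IH //; last lia.
  have [-> -> ->] : [/\ n.+3 - k = (n - k).+3, n.+2 - k = (n - k).+2 &
    n.+2 - k.+1 = (n - k).+1] by split; lia.
  by [].
(* Only the empty set remains, and [k] is [n.+1] or [n.+2], matching F_2 = F_1 = 1. *)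
rewrite shifted_schreier_subsets_trivial // cardfs1.
by have [->|->] : n.+3 - k = 1 \/ n.+3 - k = 2 by lia.
Qed.

Lemma card_shifted_schreier_with_max k n : k <= n.+1 ->
  #|` shifted_schreier_with_max k n.+1| = fib_nat (n.+1 - k).
Proof.
(* At [k = n.+1] there is no such set, in agreement with F_0 = 0. *)
rewrite leq_eqVlt => /predU1P[->|kn].
  by rewrite shifted_schreier_with_max_eq0 // subnn cardfs0.
by rewrite card_shifted_schreier_with_maxS // card_shifted_schreier_subsets.
Qed.

(** A set containing 0 has size at least 1, so 0 violates the bound. Positivity is thus
    automatic. *)
Lemma shifted_schreier_notin0 k S : shifted_schreier k S -> 0 \notin S.
Proof.
move=> /shifted_schreierP H; apply/negP => /[dup] S0 /H.
by rewrite (cardfsD1 0 S) S0.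
Qed.

Lemma weak_schreierE S : weak_schreier S = shifted_schreier 0 S.
Proof.
apply/idP/shifted_schreierP => [/andP[_ /orP[/eqP-> //|Sm]] x xS|H].
  by rewrite addn0 (leq_trans Sm) // fset_min_le.
apply/andP; split.
  by apply: (shifted_schreier_notin0 0); apply/shifted_schreierP.
have [//|/fset_min_mem /H] := eqVneq S fset0.
by rewrite addn0.
Qed.

Lemma strong_schreierE S : strong_schreier S = shifted_schreier 1 S.
Proof.
apply/idP/shifted_schreierP => [/andP[_ /orP[/eqP-> //|Sm]] x xS|H].
  by rewrite addn1 (leq_trans Sm) // fset_min_le.
apply/andP; split.
  by apply: (shifted_schreier_notin0 1); apply/shifted_schreierP.
have [//|/fset_min_mem /H] := eqVneq S fset0.
by rewrite addn1.
Qed.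

(** By antisymmetry, the minimum equals the size exactly when it is at least the size but not
    greater. *)
Lemma maximal_schreierE S :
  maximal_schreier S = [&& S != fset0, weak_schreier S & ~~ strong_schreier S].
Proof.
rewrite /maximal_schreier /weak_schreier /strong_schreier.
by case: (pos_fset S); case: (S == fset0) => //=; rewrite -leqNgt eqn_leq andbC.
Qed.

(** Links the counted families to the [fset_max] of the theorem: a subset of {1, ..., n} containing
    [n] has maximum [n]. *)
Lemma in_shifted_schreier_with_maxE k n S :
  (S \in shifted_schreier_with_max k n) =
  [&& shifted_schreier k S, S != fset0 & fset_max S == n].
Proof.
rewrite in_shifted_schreier_with_max in_shifted_schreier_subsets.
apply/idP/and3P => [/andP[/andP[/sub_interval_fsetP Sn Sk] nS]|[Sk SN0 /eqP <-]].
  have SN0 : S != fset0 by apply/fset0Pn; exists n.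
  split=> //; rewrite eqn_leq fset_max_ge // andbT.
  by case/andP: (Sn _ (fset_max_mem SN0)).
rewrite fset_max_mem // Sk !andbT; apply/sub_interval_fsetP => x xS.
rewrite fset_max_ge // lt0n andbT.
by apply: contraNneq (shifted_schreier_notin0 _ _ Sk) => <-.
Qed.

Theorem theorem1 (n : nat) (hn : (0 < n)%N) :
  [/\ (strong_schreier_with_max n #= `I_(fib (n%:Z - 1)%R))%card,
      (maximal_schreier_with_max n #= `I_(fib (n%:Z - 2)%R))%card,
      (weak_schreier_subsets n #= `I_(fib (n%:Z + 2)%R))%card &
      (strong_schreier_subsets n #= `I_(fib (n%:Z + 1)%R))%card].
Proof.
case: n hn => // n _.
have predn1 : (n.+1%:Z - 1 = n%:Z)%R by lia.
split.
- have -> : strong_schreier_with_max n.+1 =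
      [set` shifted_schreier_with_max 1 n.+1]%classic.
    apply/seteqP; split=> S /=; rewrite in_shifted_schreier_with_maxE;
      rewrite -strong_schreierE.
      by case=> -> -> ->; rewrite eqxx.
    by case/and3P => sS S0 /eqP Sn; split.
  by apply/card_eq_fsetP; rewrite card_shifted_schreier_with_max // predn1 subn1.
- have -> : maximal_schreier_with_max n.+1 =
      [set` (shifted_schreier_with_max 0 n.+1
             `\` shifted_schreier_with_max 1 n.+1)%fset]%classic.
    apply/seteqP; split=> S /=; rewrite in_fsetD !in_shifted_schreier_with_maxE;
      rewrite -weak_schreierE -strong_schreierE.
      by case; rewrite maximal_schreierE => /and3P[S0 wS /negbTE sS] Sn;
        rewrite sS wS S0 Sn eqxx.
    case/andP => + /and3P[wS S0 /eqP Sn]; rewrite S0 Sn eqxx !andbT => sS.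
    by split; rewrite ?maximal_schreierE ?S0 ?wS.
  (* Strong sets are weak, so the difference has F_(n+1) - F_n elements, which is F_(n-1). *)
  apply/card_eq_fsetP; rewrite cardfsDS; last first.
    apply/fsubsetP => S; rewrite !in_shifted_schreier_with_maxE.
    move=> /andP[/shifted_schreierP Sk ->].
    by rewrite andbT; apply/shifted_schreierP => x /Sk; lia.
  rewrite !card_shifted_schreier_with_max // subn0 subn1.
  (* For [n = 0] the index is -1, and F_1 - F_0 = 1 = F_(-1) holds by computation. *)
  case: n {predn1} => [|n] //.
  have -> : (n.+2%:Z - 2 = n%:Z)%R by lia.
  by rewrite [fib_nat n.+2]/= addKn.
- have -> : weak_schreier_subsets n.+1 =
      [set` shifted_schreier_subsets 0 n.+1]%classic.
    apply/seteqP; split=> S /=; rewrite in_shifted_schreier_subsets.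
      by case=> + ->; rewrite weak_schreierE.
    by case/andP => Sn; rewrite -weak_schreierE.
  apply/card_eq_fsetP; rewrite card_shifted_schreier_subsets // subn0.
  by have -> : (n.+1%:Z + 2 = n.+3%:Z)%R by lia.
- have -> : strong_schreier_subsets n.+1 =
      [set` shifted_schreier_subsets 1 n.+1]%classic.
    apply/seteqP; split=> S /=; rewrite in_shifted_schreier_subsets.
      by case=> + ->; rewrite strong_schreierE.
    by case/andP => Sn; rewrite -strong_schreierE.
  apply/card_eq_fsetP; rewrite card_shifted_schreier_subsets // subn1.
  by have -> : (n.+1%:Z + 1 = n.+2%:Z)%R by lia.
Qed.
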